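(* Let $(\Omega,\mathcal{H},\hat{\mathbb{E}})$ be a sub-linear expectation space with associated upper capacity $\mathbb{V}$ and conjugate expectation $\hat{\varepsilon}$. Let $1<p\leq 2$ and let $\epsilon>0$ be a real number. (1) If $\{Z_n,n\geq1\}\subset\mathcal{H}$ is a sequence of upper extended negatively dependent random variables with dominating constant $K\geq1$, such that $\hat{\mathbb{E}}[Z_n]\leq0$ and $|Z_n|\leq\epsilon$ for each $n\geq1$, then for every $n\ge 1$ $$\mathbb{V}\left(\sum_{i=1}^{n}Z_i>\epsilon\right)\leq Ke\,\epsilon^{-p}\sum_{i=1}^{n}\hat{\mathbb{E}}[|Z_i|^{p}].$$ (2) If $\{Z_n,n\geq1\}\subset\mathcal{H}$ is a sequence of extended negatively dependent (END) random variables with dominating constant $K\geq1$, such that $\hat{\mathbb{E}}[Z_n]=\hat{\varepsilon}[Z_n]=0$ and $|Z_n|\leq\epsilon$ for each $n\geq1$, then for every $n\ge1$ $$\mathbb{V}\left(\left|\sum_{i=1}^{n}Z_i\right|>\epsilon\right)\leq 2Ke\,\epsilon^{-p}\sum_{i=1}^{n}\hat{\mathbb{E}}[|Z_i|^{p}].$$ Here $e$ is the base of the natural logarithm.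
   Context: Setting. $(\Omega,\mathcal{F})$ is a measurable space and $\mathcal{H}$ is a linear space of real functions on $(\Omega,\mathcal{F})$ (called random variables) such that $X_1,\dots,X_n\in\mathcal{H}$ implies $\varphi(X_1,\dots,X_n)\in\mathcal{H}$ for each $\varphi\in C_{l,Lip}(\mathbb{R}^n)$, where $C_{l,Lip}(\mathbb{R}^n)$ is the space of functions $\varphi$ with $|\varphi(x)-\varphi(y)|\leq C(1+|x|^m+|y|^m)|x-y|$ for all $x,y\in\mathbb{R}^n$, for some $C>0$, $m\in\mathbb{N}$ depending on $\varphi$. $C_{b,Lip}(\mathbb{R}^n)$ is the space of functions with $|\varphi(x)|\leq C$ and $|\varphi(x)-\varphi(y)|\leq C|x-y|$ for all $x,y$, for some $C>0$ depending on $\varphi$. Sub-linear expectation. $\hat{\mathbb{E}}:\mathcal{H}\to[-\infty,+\infty]$ satisfies, for all $X,Y\in\mathcal{H}$: (a) $X\geq Y$ implies $\hat{\mathbb{E}}[X]\geq\hat{\mathbb{E}}[Y]$; (b) $\hat{\mathbb{E}}[c]=c$ for constants $c$; (c) $\hat{\mathbb{E}}[X+Y]\leq\hat{\mathbb{E}}[X]+\hat{\mathbb{E}}[Y]$ whenever the right side is not of the form $+\infty-\infty$ or $-\infty+\infty$; (d) $\hat{\mathbb{E}}[\lambda X]=\lambda\hat{\mathbb{E}}[X]$ for $\lambda>0$. The triple $(\Omega,\mathcal{H},\hat{\mathbb{E}})$ is a sub-linear expectation space. The conjugate expectation is $\hat{\varepsilon}[X]:=-\hat{\mathbb{E}}[-X]$.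 Capacity. For $A\in\mathcal{F}$, $\mathbb{V}(A)=\inf\{\hat{\mathbb{E}}[\xi]: I_A\leq\xi,\ \xi\in\mathcal{H}\}$, where $I_A$ is the indicator function of $A$. Extended negative dependence. A sequence $\{X_n,n\geq1\}\subset\mathcal{H}$ is upper (resp. lower) extended negatively dependent if there is a dominating constant $K\geq1$ such that $\hat{\mathbb{E}}\left[\prod_{i=1}^{n}f_i(X_i)\right]\leq K\prod_{i=1}^{n}\hat{\mathbb{E}}[f_i(X_i)]$ for all $n\geq1$, whenever the non-negative functions $f_i\in C_{b,Lip}(\mathbb{R})$, $i=1,2,\dots$, are all non-decreasing (resp. all non-increasing). The sequence is END if it is both upper and lower extended negatively dependent; its dominating constant $K$ is one for which both the upper and the lower inequality hold. *)

(* Defs.v *)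
From HB Require Import structures.
From mathcomp Require Import all_boot all_order all_algebra.
From mathcomp Require Import all_classical all_reals all_analysis.

Set Implicit Arguments.
Unset Strict Implicit.
Unset Printing Implicit Defensive.

Import Order.TTheory GRing.Theory Num.Theory.
Import numFieldNormedType.Exports.

Local Open Scope classical_set_scope.
Local Open Scope ring_scope.

(* The library norm `|x| on 'rV[R]_n is the sup norm. *)
Definition euclidean_norm (R : realType) (n : nat) (x : 'rV[R]_n) : R :=
  Num.sqrt (\sum_(i < n) x ord0 i ^+ 2).

Definition C_lLip (R : realType) (n : nat) (phi : 'rV[R]_n -> R) : Prop :=
  exists (C : R) (m : nat), 0 < C /\ forall x y : 'rV[R]_n,
    `|phi x - phi y| <=
      C * (1 + euclidean_norm x ^+ m + euclidean_norm y ^+ m)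
        * euclidean_norm (x - y).

Definition C_bLip (R : realType) (f : R -> R) : Prop :=
  exists C : R, 0 < C /\ (forall x, `|f x| <= C) /\
    (forall x y, `|f x - f y| <= C * `|x - y|).

(* No measurability of the members of H is imposed: H is a space of arbitrary
   real functions on the measurable space Omega. *)
Record random_variable_space (R : realType) (d : measure_display)
    (Omega : measurableType d) (H : set (Omega -> R)) : Prop := {
  rv_zero : H (cst 0) ;
  rv_add : forall X Y, H X -> H Y -> H (X \+ Y) ;
  rv_scale : forall (a : R) X, H X -> H (fun w => a * X w) ;
  rv_lip : forall (n : nat) (X : 'I_n -> Omega -> R) (phi : 'rV[R]_n -> R),
    (0 < n)%N -> (forall i, H (X i)) -> C_lLip phi ->
    H (fun w => phi (\row_(i < n) X i w))
}.

(* E is a total function, constrained (and used) only on H. The notation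
   x +? y says that x + y is not of the form +oo - oo or -oo + oo. *)
Record sublinear_expectation_space (R : realType) (d : measure_display)
    (Omega : measurableType d) (H : set (Omega -> R))
    (E : (Omega -> R) -> \bar R) : Prop := {
  sle_space : random_variable_space H ;
  sle_mono : forall X Y, H X -> H Y -> (forall w, Y w <= X w) ->
    (E Y <= E X)%E ;
  sle_cst : forall c : R, E (cst c) = c%:E ;
  sle_subadd : forall X Y, H X -> H Y -> (E X +? E Y)%E ->
    (E (X \+ Y)%R <= E X + E Y)%E ;
  sle_pos_homo : forall (l : R) X, H X -> 0 < l ->
    E (fun w => (l * X w)%R) = (l%:E * E X)%E
}.

Definition conjugate_expectation (R : realType) (Omega : Type)
    (E : (Omega -> R) -> \bar R) (X : Omega -> R) : \bar R :=
  (- E (fun w => (- X w)%R))%E.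

(* The infimum makes sense for every A, measurable or not. *)
Definition upper_capacity (R : realType) (Omega : Type)
    (H : set (Omega -> R)) (E : (Omega -> R) -> \bar R)
    (A : set Omega) : \bar R :=
  ereal_inf [set E xi | xi in
    [set xi | H xi /\ forall w, (\1_A w : R) <= xi w]].

(* Sequences X_1, X_2, ... are indexed from 0: X i stands for X_(i+1). *)
Definition upper_END (R : realType) (Omega : Type)
    (E : (Omega -> R) -> \bar R) (K : R) (X : nat -> Omega -> R) : Prop :=
  1 <= K /\
  forall f : nat -> R -> R,
    (forall i, C_bLip (f i)) ->
    (forall i x, 0 <= f i x) ->
    (forall i, {homo f i : x y / x <= y}) ->
    forall n : nat, (0 < n)%N ->
    (E (fun w => (\prod_(i < n) f i (X i w))%R)
      <= K%:E * \prod_(i < n) E (fun w => f i (X i w)))%E.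

Definition lower_END (R : realType) (Omega : Type)
    (E : (Omega -> R) -> \bar R) (K : R) (X : nat -> Omega -> R) : Prop :=
  1 <= K /\
  forall f : nat -> R -> R,
    (forall i, C_bLip (f i)) ->
    (forall i x, 0 <= f i x) ->
    (forall i, {homo f i : x y /~ x <= y}) ->
    forall n : nat, (0 < n)%N ->
    (E (fun w => (\prod_(i < n) f i (X i w))%R)
      <= K%:E * \prod_(i < n) E (fun w => f i (X i w)))%E.

Definition END (R : realType) (Omega : Type)
    (E : (Omega -> R) -> \bar R) (K : R) (X : nat -> Omega -> R) : Prop :=
  upper_END E K X /\ lower_END E K X.

(* Main.v *)
(* Chernoff's method. For [|x| <= epsilon], [s = t epsilon] and [1 < p <= 2],
   [exp (t x) <= 1 + t x + (exp s - 1 - s) epsilon^-p |x|^p]. Truncating the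
   exponential at level [epsilon] gives an admissible monotone test function for
   extended negative dependence, so [V (S > epsilon)] is at most
   [K exp (- s + (exp s - 1 - s) B)] where [B] is [epsilon^-p] times the sum of
   the p-th moments. The choice [s = ln (1 + B^-1)] bounds this by [K e B].
   The two-sided bound follows by applying this to [Z] and [- Z] and using
   subadditivity. *)
Require Import Defs.
From HB Require Import structures.
From mathcomp Require Import all_boot all_order all_algebra.
From mathcomp Require Import all_classical all_reals all_analysis.
From mathcomp Require Import ring lra.
Import Order.TTheory GRing.Theory Num.Theory.
Import numFieldNormedType.Exports.
Local Open Scope classical_set_scope.
Local Open Scope ring_scope.

Set Implicit Arguments.
Unset Strict Implicit.
Unset Printing Implicit Defensive.

(** * Elementary inequalities for exponentials and real powers *)

Lemma exprn_le_powR {R : realType} (r p : R) (k : nat) :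
  0 <= r <= 1 -> 0 < p <= 2 -> (2 <= k)%N -> r ^+ k <= r `^ p.
Proof.
move=> /andP[r0 r1] /andP[p0 p2] k2.
have [->|rn0] := eqVneq r 0.
  by rewrite expr0n gtn_eqF ?powR0 ?gt_eqF//; apply: leq_trans k2.
rewrite -powR_mulrn//; apply: ger_powR; first by rewrite lt0r rn0 r0.
by rewrite (le_trans p2)// ler_nat.
Qed.

(* Termwise in the exponential series, [|y|^k <= (|y|/s)^p s^k] for [k >= 2],
   because [|y|/s <= 1] and [p <= 2]. *)
Lemma expR_le_powR {R : realType} (y s p : R) :
  0 < p <= 2 -> 0 < s -> `|y| <= s ->
  expR y <= 1 + y + (`|y| / s) `^ p * (expR s - 1 - s).
Proof.
move=> hp s0 ys; set u := _ `^ p.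
have partial z n : series (exp_coeff z) n.+2
    = 1 + z + \sum_(0 <= i < n) z ^+ i.+2 / i.+2`!%:R.
  rewrite /series/= big_nat_recl// big_nat_recl// /exp_coeff/= addrA.
  by rewrite expr0 expr1 fact0 !divr1.
(* [expR y] is the limit of its partial sums, so it suffices to bound those with at least two terms;
   [1 + y] is then split off exactly and only the tail is estimated. *)
apply: limr_le; first exact: is_cvg_series_exp_coeff.
exists 2%N => // -[|[|n]]// _.
have hs : series (exp_coeff s) n.+2 <= expR s.
  apply: nondecreasing_cvgn_le; last exact: is_cvg_series_exp_coeff.
  by apply: nondecreasing_series => i _ _; apply: exp_coeff_ge0; exact: ltW.
apply: le_trans (_ : _ <= 1 + y + u * (series (exp_coeff s) n.+2 - 1 - s)) _;
  last by rewrite lerD2l ler_wpM2l ?powR_ge0// !lerD2r.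
rewrite !partial lerD2l.
rewrite (_ : _ - 1 - s = \sum_(0 <= i < n) s ^+ i.+2 / i.+2`!%:R); last by ring.
rewrite mulr_sumr; apply: ler_sum => i _; rewrite mulrA.
rewrite ler_wpM2r ?invr_ge0//; apply: le_trans (ler_norm _) _.
rewrite normrX -{1}[`|y|](divfK (lt0r_neq0 s0)) exprMn.
rewrite ler_wpM2r ?exprn_ge0 ?(ltW s0)//.
apply: exprn_le_powR => //.
by rewrite divr_ge0 ?(ltW s0)//= ler_pdivrMr// mul1r.
Qed.

(* Young's inequality applied to [a * b^(p-1)]. *)
Lemma powR_sub_le {R : realType} (a b p : R) : 1 < p -> 0 <= a -> 0 <= b ->
  b `^ p - a `^ p <= p * b `^ (p - 1) * (b - a).
Proof.
move=> p1 a0 b0.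
have p0 : 0 < p by lra.
have q0 : 0 < p - 1 by lra.
(* The exponent conjugate to [p] is [p / (p - 1)], and it turns [b^(p-1)] back into [b^p]. *)
have := @conjugate_powR R a (b `^ (p - 1)) p (p / (p - 1)) a0 (powR_ge0 _ _) p0.
rewrite divr_gt0// => /(_ isT); rewrite invf_div.
rewrite -powRrM (_ : (p - 1) * (p / (p - 1)) = p); last by field; rewrite gt_eqF.
have -> : p^-1 + (p - 1) / p = 1 by field; rewrite gt_eqF.
move=> /(_ erefl).
have -> : b `^ p = b `^ (p - 1) * b.
  have [->|bn0] := eqVneq b 0; first by rewrite mulr0 powR0 ?gt_eqF.
  by rewrite -[X in _ = _ * X](powRr1 b0) -powRD ?bn0 ?implybT// subrK.
set c := b `^ _; set d := a `^ _ => hyoung.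
have : p * (a * c) <= d + c * b * (p - 1).
  rewrite -(ler_pM2l (_ : 0 < p^-1)) ?invr_gt0// mulKf ?gt_eqF//.
  by apply: le_trans hyoung _; rewrite le_eqVlt; apply/orP; left; apply/eqP; field; rewrite gt_eqF.
nra.
Qed.

(** The slope [p b^(p-1)] grows at most linearly because [p - 1 <= 1]. This is the growth condition
    with [m = 1] that puts the p-th moment variables in [H]. *)
Lemma normr_powR_locally_lipschitz {R : realType} (p : R) :
  1 < p -> p <= 2 -> forall x y : R,
  `| `|x| `^ p - `|y| `^ p | <= 2 * p * (1 + `|x| + `|y|) * `|x - y|.
Proof.
move=> p1 p2.
have key a b : 0 <= a -> 0 <= b -> a <= b ->
    b `^ p - a `^ p <= 2 * p * (1 + a + b) * (b - a).
  move=> a0 b0 ab; apply: le_trans (powR_sub_le p1 a0 b0) _.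
  rewrite ler_wpM2r ?subr_ge0//.
  (* As [0 < p - 1 <= 1], the power is at most [b^0] when [0 < b <= 1] and at most [b^1] when
     [1 <= b]. *)
  have hb : b `^ (p - 1) <= 1 + b.
    have [b1|/ltW b1] := leP b 1.
      have [->|bn0] := eqVneq b 0; first by rewrite powR0 ?addr0// gt_eqF ?subr_gt0.
      have : b `^ (p - 1) <= b `^ 0 by apply: ger_powR; [rewrite lt0r bn0 b0|lra].
      by rewrite powRr0; lra.
    have : b `^ (p - 1) <= b `^ 1 by apply: ler_powR => //; lra.
    by rewrite powRr1//; lra.
  nra.
move=> x y.
wlog xy : x y / `|x| <= `|y|.
  move=> h; have [|/ltW] := leP `|x| `|y|; first exact: h.
  move=> yx; rewrite distrC [`|x - y|]distrC addrAC; exact: h.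
rewrite distrC ger0_norm; last first.
  by rewrite subr_ge0 ge0_ler_powR ?nnegrE//; lra.
apply: le_trans (key _ _ _ _ xy) _ => //.
rewrite ler_wpM2l//; last by rewrite distrC; apply: lerB_dist.
by rewrite mulr_ge0 ?addr_ge0//; lra.
Qed.

(** By convexity the exponential lies above its tangent at the larger of the two points, whose slope
    is at most [expR M]. *)
Lemma expR_dist {R : realType} (a b M : R) : a <= M -> b <= M ->
  `|expR a - expR b| <= expR M * `|a - b|.
Proof.
wlog ab : a b / b <= a.
  move=> h aM bM; have [ab|/ltW ab] := leP b a; first exact: h.
  by rewrite distrC [`|a - b|]distrC; exact: h.
move=> aM _; rewrite !ger0_norm ?subr_ge0 ?ler_expR//.
apply: (@le_trans _ _ (expR a * (a - b))); last first.
  by rewrite ler_wpM2r ?subr_ge0 ?ler_expR.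
have := expR_ge1Dx (b - a).
rewrite -(ler_pM2l (expR_gt0 a)) -expRD (addrC a) subrK.
lra.
Qed.

(** Truncation to [[-M, M]]: it makes [expR (t * _)] bounded and Lipschitz, keeps it non-decreasing,
    and changes nothing on values bounded by [M]. *)
Definition clip {R : realType} (M x : R) : R := Num.max (- M) (Num.min x M).

Lemma clip_id {R : realType} (M x : R) : `|x| <= M -> clip M x = x.
Proof.
by rewrite ler_norml => /andP[? ?]; rewrite /clip min_l// max_r.
Qed.

Lemma clip_le {R : realType} (M x : R) : 0 <= M -> clip M x <= M.
Proof. by move=> M0; rewrite /clip ge_max ge_min lexx orbT andbT; lra. Qed.

Lemma clip_homo {R : realType} (M : R) : {homo clip M : x y / x <= y}.
Proof.
move=> x y xy; rewrite /clip.
by have [] := leP x M; have [] := leP y M => *;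
  have [] := leP (- M) x; have [] := leP (- M) y; have [] := leP (- M) M; lra.
Qed.

Lemma clip_lipschitz {R : realType} (M x y : R) : 0 <= M ->
  `|clip M x - clip M y| <= `|x - y|.
Proof.
move=> M0; wlog xy : x y / y <= x.
  move=> h; have [|/ltW] := leP y x; first exact: h.
  by rewrite distrC [`|x - y|]distrC; exact: h.
rewrite !ger0_norm ?subr_ge0 ?clip_homo// /clip.
by have [] := leP x M; have [] := leP y M => *;
  have [] := leP (- M) x; have [] := leP (- M) y; have [] := leP (- M) M; lra.
Qed.

Lemma euclidean_norm1 {R : realType} (x : 'rV[R]_1) :
  euclidean_norm x = `|x ord0 ord0|.
Proof. by rewrite /euclidean_norm big_ord1 sqrtr_sqr. Qed.

(** * Closure properties of the space of random variables *)

Section RandomVariables.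
Context {R : realType} {d : measure_display} {Omega : measurableType d}.
Context {H : set (Omega -> R)}.

Lemma rv_comp (g : R -> R) (C : R) (m : nat) (X : Omega -> R) :
  random_variable_space H -> 0 < C ->
  (forall x y, `|g x - g y| <= C * (1 + `|x| ^+ m + `|y| ^+ m) * `|x - y|) ->
  H X -> H (g \o X).
Proof.
move=> hH C0 hg HX.
have := rv_lip hH (X := fun=> X) (phi := fun x : 'rV[R]_1 => g (x ord0 ord0)) isT (fun=> HX).
have -> : (fun w => g ((\row_(i < 1) X w) ord0 ord0)) = g \o X.
  by apply/funext => w; rewrite mxE.
apply; exists C, m; split => // x y.
by rewrite !euclidean_norm1 !mxE; exact: hg.
Qed.

Lemma rv_comp_lipschitz (g : R -> R) (C : R) (X : Omega -> R) :
  random_variable_space H -> 0 < C ->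
  (forall x y, `|g x - g y| <= C * `|x - y|) -> H X -> H (g \o X).
Proof.
move=> hH C0 hg; apply: (rv_comp (m := 0) hH C0) => x y.
apply: le_trans (hg x y) _; rewrite !expr0 ler_wpM2r// ler_peMr ?ltW//.
lra.
Qed.

Lemma rv_cst (c : R) : random_variable_space H -> H (cst c).
Proof.
move=> hH; apply: (rv_comp_lipschitz (g := cst c) (C := 1) (X := cst 0) hH) => //.
  by move=> x y; rewrite subrr normr0 mul1r.
exact: rv_zero hH.
Qed.

Lemma rv_opp (X : Omega -> R) : random_variable_space H ->
  H X -> H (fun w => - X w).
Proof.
move=> hH HX; rewrite (_ : (fun w => - X w) = (fun w => -1 * X w)).
  exact: (rv_scale hH _ HX).
by apply/funext => w; rewrite mulN1r.
Qed.

Lemma rv_sum (Z : nat -> Omega -> R) (n : nat) :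
  random_variable_space H -> (forall i, H (Z i)) ->
  H (fun w => \sum_(i < n) Z i w).
Proof.
move=> hH HZ; elim: n => [|n IH].
  rewrite (_ : (fun _ => _) = cst 0); first exact: rv_zero hH.
  by apply/funext => w; rewrite big_ord0.
rewrite (_ : (fun _ => _) = (fun w => \sum_(i < n) Z i w) \+ Z n).
  exact: (rv_add hH IH (HZ n)).
by apply/funext => w; rewrite big_ord_recr.
Qed.

Lemma rv_normr_powR (p : R) (X : Omega -> R) :
  random_variable_space H -> 1 < p -> p <= 2 ->
  H X -> H (fun w => `|X w| `^ p).
Proof.
move=> hH p1 p2; apply: (rv_comp (g := fun x => `|x| `^ p) (C := 2 * p) (m := 1) hH); first lra.
exact: normr_powR_locally_lipschitz.
Qed.

End RandomVariables.

(** * Truncated exponentials as test functions *)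

Lemma expR_clip_lipschitz {R : realType} (t M : R) : 0 < t -> 0 <= M ->
  forall x y, `|expR (t * clip M x) - expR (t * clip M y)|
    <= expR (t * M) * t * `|x - y|.
Proof.
move=> t0 M0 x y; have hc z : t * clip M z <= t * M.
  by rewrite ler_pM2l// clip_le.
apply: le_trans (expR_dist (hc x) (hc y)) _.
rewrite -mulrA ler_pM2l ?expR_gt0// -mulrBr normrM (gtr0_norm t0) ler_pM2l//.
exact: clip_lipschitz.
Qed.

Lemma C_bLip_expR_clip {R : realType} (t M : R) : 0 < t -> 0 <= M ->
  C_bLip (fun x => expR (t * clip M x)).
Proof.
move=> t0 M0; exists (expR (t * M) * (1 + t)); split; last split.
- by rewrite mulr_gt0 ?expR_gt0 ?addr_gt0.
- move=> x; rewrite ger0_norm ?expR_ge0//.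
  apply: (@le_trans _ _ (expR (t * M))).
    by rewrite ler_expR ler_pM2l// clip_le.
  by rewrite ler_peMr ?expR_ge0// lerDl ltW.
- move=> x y; apply: le_trans (expR_clip_lipschitz t0 M0 x y) _.
  by rewrite ler_wpM2r// ler_pM2l ?expR_gt0// lerDr.
Qed.

(** * Expectation bounds and the Chernoff estimate *)

Section SublinearExpectation.
Context {R : realType} {d : measure_display} {Omega : measurableType d}.
Context {H : set (Omega -> R)} {E : (Omega -> R) -> \bar R}.
Context (hE : sublinear_expectation_space H E).

Let hH : random_variable_space H := sle_space hE.

Lemma sle_ge_cst (c : R) (X : Omega -> R) :
  H X -> (forall w, c <= X w) -> (c%:E <= E X)%E.
Proof.
move=> HX h; rewrite -(sle_cst hE).
exact: (sle_mono hE HX (rv_cst c hH)).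
Qed.

Lemma sle_le_cst (c : R) (X : Omega -> R) :
  H X -> (forall w, X w <= c) -> (E X <= c%:E)%E.
Proof.
move=> HX h; rewrite -(sle_cst hE).
exact: (sle_mono hE (rv_cst c hH) HX).
Qed.

Lemma sle_fin_num (c : R) (X : Omega -> R) :
  H X -> (forall w, `|X w| <= c) -> E X \is a fin_num.
Proof.
move=> HX h; rewrite fin_numElt; apply/andP; split.
  apply: lt_le_trans (ltNyr (- c)) _; apply: sle_ge_cst => // w.
  by have := h w; rewrite ler_norml => /andP[].
apply: le_lt_trans (ltry c); apply: sle_le_cst => // w.
exact: le_trans (ler_norm _) (h w).
Qed.

Lemma moment_fin_num (p epsilon : R) (X : Omega -> R) : 1 < p -> p <= 2 ->
  H X -> (forall w, `|X w| <= epsilon) -> E (fun w => `|X w| `^ p) \is a fin_num.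
Proof.
move=> p1 p2 HX hX; apply: (@sle_fin_num (epsilon `^ p)).
  exact: rv_normr_powR.
move=> w; rewrite ger0_norm ?powR_ge0//.
have e0 := le_trans (normr_ge0 _) (hX w).
by rewrite ge0_ler_powR ?nnegrE//; lra.
Qed.

(** Take expectations in the pointwise bound [expR (t x) <= 1 + t x + q |x|^p]: the linear term
    contributes at most 0, and [1 + z <= expR z] puts the result in a form that multiplies well over
    [i]. *)
Lemma exponential_moment_le (p epsilon t : R) (X : Omega -> R) :
  1 < p -> p <= 2 -> 0 < epsilon -> 0 < t -> H X -> (E X <= 0)%E ->
  (forall w, `|X w| <= epsilon) ->
  (E (fun w => expR (t * clip epsilon (X w)))
    <= (expR ((expR (t * epsilon) - 1 - t * epsilon)
          * (epsilon `^ (- p) * fine (E (fun w => `|X w| `^ p)%R))))%:E)%E.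
Proof.
move=> p1 p2 e0 t0 HX EX hX.
set c := expR (t * epsilon) - 1 - t * epsilon.
set b := fine _.
set q := c * epsilon `^ (- p).
have c0 : 0 < c.
  rewrite /c; have te : t * epsilon != 0 by rewrite gt_eqF ?mulr_gt0.
  by have := expR_gt1Dx te; lra.
have q0 : 0 < q by rewrite mulr_gt0 ?powR_gt0.
have HP := rv_normr_powR hH p1 p2 HX.
have Eb : E (fun w => `|X w| `^ p) = b%:E.
  by rewrite fineK//; exact: moment_fin_num hX.
have HtX := rv_scale hH t HX.
have HqP := rv_scale hH q HP.
have HtqP := rv_add hH HtX HqP.
have EqP : E (fun w => q * `|X w| `^ p) = (q * b)%:E.
  by rewrite (sle_pos_homo hE)// Eb.
have EtX : (E (fun w => (t * X w)%R) <= 0)%E.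
  by rewrite (sle_pos_homo hE)// mule_ge0_le0 ?lee_fin ?(ltW t0).
pose Y := cst 1 \+ ((fun w => t * X w) \+ (fun w => q * `|X w| `^ p)).
apply: (@le_trans _ _ (E Y)).
  apply: (sle_mono hE).
  - exact: (rv_add hH (rv_cst 1 hH) HtqP).
  - apply: (rv_comp_lipschitz (g := fun x => expR (t * clip epsilon x))
      (C := expR (t * epsilon) * t) hH) => //.
      by rewrite mulr_gt0 ?expR_gt0.
    by apply: expR_clip_lipschitz => //; exact: ltW.
  (* Since [|X w| <= epsilon], the truncation disappears, and the series bound applies at
     [y = t * X w], [s = t * epsilon]; the factor [t] cancels in [|y| / s]. *)
  - move=> w; rewrite clip_id// /Y/=.
    apply: le_trans (@expR_le_powR _ (t * X w) (t * epsilon) p _ _ _) _.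
    + by apply/andP; split => //; lra.
    + exact: mulr_gt0.
    + by rewrite normrM gtr0_norm// ler_pM2l.
    rewrite -/c -addrA lerD2l lerD2l normrM gtr0_norm// -mulf_div divff ?gt_eqF//.
    rewrite mul1r powRM ?invr_ge0 ?(ltW e0)// -powR_inv1 ?(ltW e0)// -powRrM mulN1r.
    by rewrite [X in _ <= X](_ : _ = `|X w| `^ p * epsilon `^ (- p) * c)// /q; ring.
(* In both uses of subadditivity one summand is finite, which excludes [+oo - oo]. *)
apply: le_trans (sle_subadd hE (rv_cst 1 hH) HtqP _) _.
  by rewrite (sle_cst hE) fin_num_adde_defr.
rewrite (sle_cst hE).
have hsub : (E ((fun w => t * X w) \+ (fun w => q * `|X w| `^ p))%R <= (q * b)%:E)%E.
  apply: le_trans (sle_subadd hE HtX HqP _) _; rewrite EqP.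
    by rewrite fin_num_adde_defl.
  by rewrite -[leRHS]add0e leeD2r.
apply: le_trans (leeD2l _ hsub) _.
by rewrite -EFinD lee_fin mulrA expR_ge1Dx.
Qed.

(* With [s = ln (1 + B^-1)] the Chernoff bound [exp (- s + (exp s - 1 - s) B)]
   equals [exp (1 - s B) B / (1 + B)]; asking only that [B] dominate the moment
   sum allows [B > 0] even when that sum vanishes. *)
Lemma exists_exponential_majorant (p epsilon K B : R) (Z : nat -> Omega -> R)
    (n : nat) :
  1 < p -> p <= 2 -> 0 < epsilon -> (forall i, H (Z i)) ->
  upper_END E K Z -> (forall i, (E (Z i) <= 0)%E) ->
  (forall i w, `|Z i w| <= epsilon) -> (0 < n)%N -> 0 < B ->
  epsilon `^ (- p) * \sum_(i < n) fine (E (fun w => `|Z i w| `^ p)) <= B ->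
  exists xi, [/\ H xi,
    forall w, \1_[set w | epsilon < \sum_(i < n) Z i w] w <= xi w &
    (E xi <= (K * expR 1 * B)%:E)%E].
Proof.
move=> p1 p2 e0 HZ [K1 hEND] EZ hZ n0 B0 hB.
have Bi0 : 0 < B^-1 by rewrite invr_gt0.
pose s := ln (1 + B^-1).
have s0 : 0 < s by rewrite ln_gt0// ltrDl.
have expRs : expR s = 1 + B^-1 by rewrite lnK// posrE addr_gt0.
pose t := s / epsilon.
have t0 : 0 < t by rewrite divr_gt0.
have te : t * epsilon = s by rewrite divfK// gt_eqF.
pose f (x : R) := expR (t * clip epsilon x).
pose S w := \sum_(i < n) Z i w.
pose M := \sum_(i < n) epsilon.
have M0 : 0 <= M by apply: sumr_ge0 => i _; exact: ltW.
have SM w : `|S w| <= M.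
  by apply: le_trans (ler_norm_sum _ _ _) _; apply: ler_sum => i _.
(* [M] is [n * epsilon], a bound for [|S|]. Truncating there leaves the exponential of [t * S]
   unchanged but exhibits it as a Lipschitz function of [S], hence a member of [H]. *)
pose xi0 w := expR (t * clip M (S w)).
have Hxi0 : H xi0.
  apply: (rv_comp_lipschitz (g := fun x => expR (t * clip M x))
      (C := expR (t * M) * t) hH).
  - by rewrite mulr_gt0 ?expR_gt0.
  - exact: expR_clip_lipschitz.
  - exact: (rv_sum n hH HZ).
have xi0E : xi0 = (fun w => \prod_(i < n) f (Z i w)).
  apply/funext => w; rewrite /xi0 clip_id// mulr_sumr expR_sum.
  by apply: eq_bigr => i _; rewrite /f clip_id.
(* On the event [S > epsilon] one has [t * S >= t * epsilon = s], so the factor [expR (- s)] still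
   leaves a value of at least 1. *)
exists (fun w => expR (- s) * xi0 w); split.
- exact: (rv_scale hH _ Hxi0).
- move=> w; rewrite indicE; case: (boolP (w \in _)) => [|_] /=.
    rewrite inE/= => hS; rewrite /xi0 clip_id// -expRD.
    rewrite -[leLHS]expR0 ler_expR.
    by have := ltW hS; rewrite -(ler_pM2l t0) te -/(S w); lra.
  by rewrite mulr_ge0 ?expR_ge0.
rewrite (sle_pos_homo hE) ?expR_gt0// xi0E.
have fhomo : {homo f : x y / x <= y}.
  by move=> x y xy; rewrite ler_expR ler_pM2l// clip_homo.
have /(_ _ n0) hprod := hEND (fun=> f) (fun=> C_bLip_expR_clip t0 (ltW e0))
  (fun _ _ => expR_ge0 _) (fun=> fhomo).
pose c := expR s - 1 - s.
pose b i := epsilon `^ (- p) * fine (E (fun w => `|Z i w| `^ p)).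
have hf i : (E (fun w => f (Z i w)) <= (expR (c * b i))%:E)%E.
  by rewrite /c -te; exact: exponential_moment_le.
have f0 i : (0 <= E (fun w => f (Z i w)))%E.
  apply: sle_ge_cst => [|w]; last exact: expR_ge0.
  apply: (rv_comp_lipschitz (g := f) (C := expR (t * epsilon) * t) hH) => //.
    by rewrite mulr_gt0 ?expR_gt0.
  by apply: expR_clip_lipschitz => //; exact: ltW.
have hprod2 : (\prod_(i < n) E (fun w => f (Z i w)) <= (expR (c * B))%:E)%E.
  apply: (@le_trans _ _ (\prod_(i < n) (expR (c * b i))%:E)%E).
    elim: n {n0 hB S M M0 SM xi0 Hxi0 xi0E hprod} => [|n IH].
      by rewrite !big_ord0.
    by rewrite !big_ord_recr/= lee_pmul// prode_ge0.
  rewrite prodEFin lee_fin -expR_sum ler_expR -mulr_sumr -mulr_sumr.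
  by rewrite ler_wpM2l// /c; have := expR_ge1Dx s; lra.
have K0 : 0 <= K by lra.
apply: (@le_trans _ _ ((expR (- s))%:E * (K%:E * (expR (c * B))%:E))%E).
  rewrite lee_pmul2l ?lte_fin ?expR_gt0//.
  by apply: le_trans hprod _; rewrite lee_wpmul2l ?lee_fin.
rewrite -!EFinM lee_fin -[leRHS]mulrA mulrCA ler_wpM2l// -expRD.
(* The choice of [s] gives [c = B^-1 - s]. *)
have -> : c * B = 1 - s * B by rewrite /c expRs; field; rewrite gt_eqF.
(* Drop the factor [expR (- s * B) <= 1]; then [expR (- s)] is [(1 + B^-1)^-1], which is at most
   [B]. *)
apply: (@le_trans _ _ (expR (1 - s))).
  by rewrite ler_expR; have := mulr_gt0 s0 B0; lra.
rewrite expRD ler_pM2l ?expR_gt0// expRN expRs.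
by rewrite -[leRHS]invrK lef_pV2 ?posrE ?addr_gt0// lerDr.
Qed.

Lemma upper_capacity_le (A : set Omega) (xi : Omega -> R) :
  H xi -> (forall w, \1_A w <= xi w) -> (upper_capacity H E A <= E xi)%E.
Proof. by move=> Hxi hxi; apply: ereal_inf_lbound; exists xi. Qed.

(** Nonnegativity together with the upper bound makes [E Y] finite, so that subadditivity is
    applicable although [E] may take infinite values. *)
Lemma sle_add_le (a b : R) (X Y : Omega -> R) : H X -> H Y ->
  (forall w, 0 <= X w) -> (forall w, 0 <= Y w) ->
  (E X <= a%:E)%E -> (E Y <= b%:E)%E -> (E (X \+ Y)%R <= (a + b)%:E)%E.
Proof.
move=> HX HY X0 Y0 Xa Yb.
have Yfin : E Y \is a fin_num.
  by rewrite ge0_fin_numE ?(le_lt_trans Yb) ?ltry// sle_ge_cst.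
apply: le_trans (sle_subadd hE HX HY _) _.
  exact: fin_num_adde_defl.
by rewrite EFinD leeD.
Qed.

End SublinearExpectation.

(** Precomposing with negation turns non-decreasing test functions into non-increasing ones and
    preserves their bound and Lipschitz constant. *)
Lemma lower_END_opp {R : realType} {Omega : Type} {E : (Omega -> R) -> \bar R}
    (K : R) (Z : nat -> Omega -> R) :
  lower_END E K Z -> upper_END E K (fun i w => - Z i w).
Proof.
move=> [K1 hEND]; split => // f fLip f0 fhomo n n0.
apply: (hEND (fun i x => f i (- x))) => //.
- move=> i; have [C [C0 [fC fL]]] := fLip i; exists C; split => //; split => // x y.
  by rewrite (le_trans (fL _ _))// -opprD normrN.
- by move=> i x y xy; apply: fhomo; rewrite lerN2.
Qed.

(** Lets [B] decrease to [b]. It recovers the sharp constant from majorants that exist only for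
    [B > 0], including the case of a vanishing moment sum. *)
Lemma lee_of_forall_gt {R : realType} (v : \bar R) (a b : R) : 0 < a ->
  (forall B, b < B -> (v <= (a * B)%:E)%E) -> (v <= (a * b)%:E)%E.
Proof.
move=> a0 h; apply/lee_addgt0Pr => e e0.
have := h (b + e / a); rewrite ltrDl divr_gt0// => /(_ isT).
by rewrite mulrDr mulrCA divff ?gt_eqF// mulr1 EFinD.
Qed.

Theorem theorem2p1 (R : realType) (d : measure_display)
    (Omega : measurableType d) (H : set (Omega -> R))
    (E : (Omega -> R) -> \bar R)
    (hE : sublinear_expectation_space H E)
    (p epsilon : R) (hp1 : 1 < p) (hp2 : p <= 2) (heps : 0 < epsilon) :
  (forall (K : R) (Z : nat -> Omega -> R),
     (forall i, H (Z i)) ->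
     upper_END E K Z ->
     (forall i, (E (Z i) <= 0)%E) ->
     (forall i w, `|Z i w| <= epsilon) ->
     forall n : nat, (0 < n)%N ->
     (upper_capacity H E [set w | (epsilon < \sum_(i < n) Z i w)%R]
       <= (K * expR 1 * epsilon `^ (- p))%:E
          * \sum_(i < n) E (fun w => (`|Z i w| `^ p)%R))%E)
  /\
  (forall (K : R) (Z : nat -> Omega -> R),
     (forall i, H (Z i)) ->
     END E K Z ->
     (forall i, E (Z i) = 0%E /\ conjugate_expectation E (Z i) = 0%E) ->
     (forall i w, `|Z i w| <= epsilon) ->
     forall n : nat, (0 < n)%N ->
     (upper_capacity H E [set w | (epsilon < `|\sum_(i < n) Z i w|)%R]
       <= (2 * K * expR 1 * epsilon `^ (- p))%:E
          * \sum_(i < n) E (fun w => (`|Z i w| `^ p)%R))%E).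
Proof.
have moment_sum (Z : nat -> Omega -> R) n : (forall i, H (Z i)) ->
    (forall i w, `|Z i w| <= epsilon) ->
    (\sum_(i < n) E (fun w => (`|Z i w| `^ p)%R))%E
      = (\sum_(i < n) fine (E (fun w => `|Z i w| `^ p)))%:E.
  move=> HZ hZ; rewrite -sumEFin; apply: eq_bigr => i _.
  by rewrite fineK// (moment_fin_num hE hp1 hp2 (HZ i) (hZ i)).
have bound_ge0 (Z : nat -> Omega -> R) n : (forall i, H (Z i)) ->
    0 <= epsilon `^ (- p) * \sum_(i < n) fine (E (fun w => `|Z i w| `^ p)).
  move=> HZ; rewrite mulr_ge0 ?powR_ge0// sumr_ge0// => i _.
  apply: fine_ge0; apply: (sle_ge_cst hE) => [|w]; last exact: powR_ge0.
  exact: (rv_normr_powR (sle_space hE) hp1 hp2 (HZ i)).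
split=> K Z HZ hEND EZ hZ n n0; rewrite moment_sum// -EFinM -[X in X%:E]mulrA.
  (* One-sided bound: for each [B] above the normalized moment sum, the majorant is admissible in
     the infimum defining the capacity. *)
  have K1 := hEND.1; apply: lee_of_forall_gt => [|B hB].
    by rewrite mulr_gt0 ?expR_gt0//; lra.
  have [xi [Hxi h1 h2]] := exists_exponential_majorant hE hp1 hp2 heps HZ hEND
    EZ hZ n0 (le_lt_trans (bound_ge0 Z n HZ) hB) (ltW hB).
  exact: le_trans (upper_capacity_le Hxi h1) h2.
have K1 := hEND.1.1; apply: lee_of_forall_gt => [|B hB].
  by rewrite !mulr_gt0 ?expR_gt0//; lra.
have B0 := le_lt_trans (bound_ge0 Z n HZ) hB.
have EZ0 i : (E (Z i) <= 0)%E by rewrite (EZ i).1.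
(* The vanishing conjugate expectation is the mean condition for [- Z i]. *)
have ENZ0 i : (E (fun w => (- Z i w)%R) <= 0)%E.
  by have /eqP := (EZ i).2; rewrite oppe_eq0 => /eqP ->.
have HNZ i := rv_opp (sle_space hE) (HZ i).
have hNZ i w : `|- Z i w| <= epsilon by rewrite normrN.
have hNB : epsilon `^ (- p) * \sum_(i < n) fine (E (fun w => `|- Z i w| `^ p)) <= B.
  apply: le_trans (ltW hB); rewrite le_eqVlt; apply/orP; left; apply/eqP.
  congr (_ * _); apply: eq_bigr => i _; congr (fine (E _)).
  by apply/funext => w; rewrite normrN.
have [xi [Hxi h1 h2]] := exists_exponential_majorant hE hp1 hp2 heps HZ hEND.1
  EZ0 hZ n0 B0 (ltW hB).
have [eta [Heta k1 k2]] := exists_exponential_majorant hE hp1 hp2 heps HNZ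
  (lower_END_opp hEND.2) ENZ0 hNZ n0 B0 hNB.
have indic_ge0 (A : set Omega) w : 0 <= \1_A w :> R by rewrite indicE.
have xi0 w := le_trans (indic_ge0 _ w) (h1 w).
have eta0 w := le_trans (indic_ge0 _ w) (k1 w).
(* The two-sided event is the union of the two one-sided ones. As both majorants are nonnegative,
   their sum dominates its indicator, and adding the two bounds produces the factor 2. *)
apply: (@le_trans _ _ (E (xi \+ eta))).
  apply: upper_capacity_le; first exact: (rv_add (sle_space hE) Hxi Heta).
  move=> w /=; rewrite indicE; case: (boolP (w \in _)) => [|_] /=; last by rewrite addr_ge0.
  rewrite inE/= ltr_normr => /orP[] hw.
    apply: le_trans (_ : _ <= xi w) _; last by rewrite lerDl.
    by apply: le_trans (h1 w); rewrite indicE mem_set.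
  apply: le_trans (_ : _ <= eta w) _; last by rewrite lerDr.
  by apply: le_trans (k1 w); rewrite indicE mem_set//= sumrN.
apply: le_trans (sle_add_le hE Hxi Heta xi0 eta0 h2 k2) _.
by rewrite lee_fin; lra.
Qed.
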